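(* Let $J$ be a directed infinite set and let $\{K_j: j\in J\}$ be a family of algebraic objects with binary operations $\mu_1,\dots,\mu_n$, with algebraic embeddings $t^j_k$ and index maps $\psi_p,\phi_p:J\to J$ as in the context. If each $K_j$ is non-trivial (contains not only neutral elements relative to the binary operations $\mu_1,\dots,\mu_n$) and there is a number $p$, $1\le p\le n$, such that $j<\phi_p(j)$ for each $j\in J$, then the algebraic object $s(K_j: j\in J)$ is non-associative relative to the binary operation $\mu_p$.
   Context: An algebraic object is a set $K$ with binary operations $\mu_1,\dots,\mu_n$. An element $e$ is neutral for $\mu$ if $\mu(e,b)=\mu(b,e)=b$ for all $b\in K$. A set is directed by a relation $\le$ if $\le$ is transitive, reflexive, and any two elements have a common upper bound; $x<y$ means $x\le y$ and $x\neq y$. Construction of $s(K_j: j\in J)$. Let $J$ be a directed infinite set. Assume: - for each $k<j$ in $J$ there is an injective map $t^j_k:K_j\hookrightarrow K_k$ with $\mu_l(t^j_k(a),t^j_k(b))=t^j_k(\mu_l(a,b))$ for all $a,b\in K_j$, $l=1,\dots,n$ (and $t^j_j$ is the identity); - for each $p=1,\dots,n$, $\psi_p:J\to J$ is a bijection with $\psi_p(j)\le j$ for all $j$ and $\psi_p(k)<\psi_p(j)$ for $k<j$; - for each $p=1,\dots,n$, $\phi_p:J\to J$ is bijective with $j\le\phi_p(j)$ for all $j$ and $\phi_p(k)<\phi_p(j)$ for $k<j$. Then $s(K_j: j\in J)$ is the set $\prod_{j\in J}K_j$ with operations $\mu_p(y,z)=q$, where $q_{\psi_p(j)}=\mu_p\bigl(y_j,t^{\phi_p(j)}_j(z_{\phi_p(j)})\bigr)$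 for each $j\in J$, the right-hand element of $K_j$ being viewed in $K_{\psi_p(j)}$ via $t^j_{\psi_p(j)}$.
   Formalization: Each K_j is assumed to contain a neutral element for the operation μ_p, as ''not only neutral elements'' suggests; without it the claim fails, e.g. for J = ℤ, K_j = {0,1}, μ constantly 0, φ(j) = j+1. *)

(* Defs.v *)
From mathcomp Require Import all_boot.
From mathcomp Require Import boolp classical_sets functions cardinality.

Set Implicit Arguments.
Unset Strict Implicit.
Unset Printing Implicit Defensive.

Record alg_object (n : nat) := AlgObject {
  carrier :> Type;
  op : 'I_n -> carrier -> carrier -> carrier
}.

Definition neutral (T : Type) (mu : T -> T -> T) (e : T) : Prop :=
  left_id e mu /\ right_id e mu.

(* An element is "neutral relative to the operations" when it is neutral for
   at least one of them, as 0 and 1 are in a ring. *)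
Definition nontrivial (n : nat) (A : alg_object n) : Prop :=
  exists a : A, ~ exists l : 'I_n, neutral (op l) a.

(* Antisymmetry is not required, so [strict] must carry the disequality. *)
Definition directed (J : Type) (le : J -> J -> Prop) : Prop :=
  [/\ forall i, le i i,
      forall i j k, le i j -> le j k -> le i k &
      forall i j, exists k, le i k /\ le j k].

Definition strict (J : Type) (le : J -> J -> Prop) (i j : J) : Prop :=
  le i j /\ i <> j.

(* [emb k j] is the map t^j_k : K_j -> K_k. No compatibility of the form
   t^j_k \o t^i_j = t^i_k is assumed, nor preservation of neutral elements. *)
Record skew_system (J : Type) (le : J -> J -> Prop) (n : nat)
    (K : J -> alg_object n) := SkewSystem {
  emb : forall k j, le k j -> K j -> K k;
  emb_id : forall j (h : le j j) (a : K j), emb h a = a;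
  emb_inj : forall k j (h : le k j), injective (emb h);
  emb_op : forall k j (h : le k j) (l : 'I_n) (a b : K j),
    op l (emb h a) (emb h b) = emb h (op l a b);
  psi : 'I_n -> J -> J;
  psi_bij : forall p, bijective (psi p);
  psi_le : forall p j, le (psi p j) j;
  psi_strict : forall p k j, strict le k j -> strict le (psi p k) (psi p j);
  phi : 'I_n -> J -> J;
  phi_bij : forall p, bijective (phi p);
  phi_ge : forall p j, le j (phi p j);
  phi_strict : forall p k j, strict le k j -> strict le (phi p k) (phi p j)
}.

Section SkewProduct.
Variables (J : Type) (le : J -> J -> Prop) (n : nat) (K : J -> alg_object n).
Variable S : skew_system le K.

Lemma psi_preimage (p : 'I_n) (k : J) : exists j, psi S p j = k.
Proof. by have [g _ gK] := psi_bij S p; exists (g k). Qed.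

Definition psi_inv (p : 'I_n) (k : J) : J := sval (cid (psi_preimage p k)).

Lemma psi_invK (p : 'I_n) (k : J) : psi S p (psi_inv p k) = k.
Proof. exact: svalP (cid (psi_preimage p k)). Qed.

Lemma psiK (p : 'I_n) (j : J) : psi_inv p (psi S p j) = j.
Proof. by apply: (bij_inj (psi_bij S p)); rewrite psi_invK. Qed.

Lemma le_psi_inv (p : 'I_n) (k : J) : le k (psi_inv p k).
Proof. by have := psi_le S p (psi_inv p k); rewrite psi_invK. Qed.

(* The coordinate of index k = psi_p(j), with j = psi_inv p k;
   see [skew_opE] for the form indexed by j. *)
Definition skew_op (p : 'I_n) (y z : forall j, K j) (k : J) : K k :=
  let j := psi_inv p k in
  emb S (le_psi_inv p k) (op p (y j) (emb S (phi_ge S p j) (z (phi S p j)))).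

Definition skew_product : alg_object n := AlgObject skew_op.

Lemma skew_opE (p : 'I_n) (y z : skew_product) (j : J) :
  op p y z (psi S p j) =
  emb S (psi_le S p j) (op p (y j) (emb S (phi_ge S p j) (z (phi S p j)))).
Proof.
rewrite /= /skew_op; move: (le_psi_inv p (psi S p j)); rewrite psiK => h.
by rewrite (Prop_irrelevance h (psi_le S p j)).
Qed.

End SkewProduct.

(* Main.v *)
Require Import Defs.
From mathcomp Require Import all_boot.
From mathcomp Require Import boolp classical_sets functions cardinality.

(** Write [t] for the embeddings and [i = psi_p^-1 j], [m = psi_p^-1 (phi_p j)].
    Cancelling the injective outer embedding, associativity of the skew
    operation at the coordinate [psi_p j] says

      mu (x_j, t t mu(y_m, t z_(phi m)))
        = mu (t mu(x_i, t y_(phi i)), t z_(phi j))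

    for all families [x], [y], [z] ([skew_assoc_coord]).  The two sides read
    different coordinates, so the proof changes a single coordinate that only
    one side reads, and arranges for that side to change.

    - If [psi j <> j], then [i <> j], so the right side ignores [x_j].  The
      families [y], [z] are chosen so that the second factor on the left side
      is the image of a neutral element under a composite [u] of embeddings;
      for [x_j = u b] the left side is [u b], which is not constant in [b].
    - If [psi j = j], then [m <> j], since [m = j] would give
      [psi j = phi j], hence [j = phi j]; as [phi] is injective, the left
      side ignores [z_(phi j)].  For [y_(phi j) = e] neutral and [x_j = t e],
      the right side is [t z_(phi j)], which is not constant.

    An embedding [t] need not preserve neutral elements: [t e] is only neutral
    for the image of [t].  This is why each choice above takes all the factors
    involved in the image of the same composite of embeddings. *)

Set Implicit Arguments.
Unset Strict Implicit.
Unset Printing Implicit Defensive.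

Local Open Scope classical_set_scope.

Lemma nontrivial_neutral (n : nat) (A : alg_object n) (p : 'I_n) :
  nontrivial A -> (exists e : A, neutral (op p) e) ->
  exists ea : A * A, neutral (op p) ea.1 /\ ea.2 <> ea.1.
Proof.
move=> [a a_nn] [e e_n]; exists (e, a); split=> //= ae.
by apply: a_nn; exists p; rewrite ae.
Qed.

Section SkewCoordinates.
Variables (J : Type) (le : J -> J -> Prop) (n : nat) (K : J -> alg_object n).
Variables (S : skew_system le K) (p : 'I_n).
Implicit Types x y z w : forall j, K j.

(** The coordinates of [z] as they enter a product from the right.  Used as a
    left factor, this family lies in the same image as the right factor does,
    so that the product can be computed inside that image. *)
Definition shift z k : K k := emb S (phi_ge S p k) (z (phi S p k)).

(** The path from [K_(phi i)], [i = psi^-1 k], through [K_i] to [K_k], along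
    which right factors enter the coordinate [k] of a product. *)
Definition pull k (a : K (phi S p (psi_inv S p k))) : K k :=
  emb S (le_psi_inv S p k) (emb S (phi_ge S p (psi_inv S p k)) a).

Lemma pull_inj k : injective (@pull k).
Proof. by move=> a b ab; apply: emb_inj (emb_inj ab). Qed.

Lemma pull_op (k : J) (a b : K (phi S p (psi_inv S p k))) :
  op p (pull a) (pull b) = pull (op p a b).
Proof. by rewrite /pull !emb_op. Qed.

Lemma skew_op_shift y z k :
  skew_op S p (shift y) z k =
  pull (op p (y (phi S p (psi_inv S p k))) (z (phi S p (psi_inv S p k)))).
Proof. by rewrite /skew_op /shift emb_op. Qed.

Lemma skew_op_local y y' z z' k :
  y (psi_inv S p k) = y' (psi_inv S p k) ->
  z (phi S p (psi_inv S p k)) = z' (phi S p (psi_inv S p k)) ->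
  skew_op S p y z k = skew_op S p y' z' k.
Proof. by move=> eq_y eq_z; rewrite /skew_op eq_y eq_z. Qed.

Lemma pull_fixed z k : psi_inv S p k = k ->
  pull (z (phi S p (psi_inv S p k))) = shift z k.
Proof.
move=> ik; rewrite /pull /shift; move: (le_psi_inv S p k); rewrite ik => h.
exact: emb_id.
Qed.

(** Associativity read at the coordinate [psi_p j], where the outer embedding
    is injective and can be cancelled. *)
Lemma skew_assoc_coord x y z j :
  associative (op p : skew_product S -> skew_product S -> skew_product S) ->
  op p (x j) (shift (skew_op S p y z) j) =
  op p (skew_op S p x y j) (shift z j).
Proof.
move=> /(_ x y z)/(congr1 (fun f : skew_product S => f (psi S p j))).
by rewrite !skew_opE => eqj; apply: emb_inj eqj.
Qed.

Variables (e a : forall j, K j).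
Hypothesis e_neutral : forall j, neutral (op p) (e j).
Hypothesis a_neq : forall j, a j <> e j.

(** Taking the new value from a family [a] avoids transporting an element of
    [K_j] along an equality of indices. *)
Definition bump_at j k : K k := if `[< k = j >] then a k else e k.

Lemma bump_at_eq j : bump_at j j = a j.
Proof. by rewrite /bump_at asboolT. Qed.

Lemma bump_at_neq j k : k <> j -> bump_at j k = e k.
Proof. by move=> kj; rewrite /bump_at asboolF. Qed.

(** In [skew_assoc_coord] the left side reads [x_j]; the right side
    reads [x] only at [psi_p^-1 j]. *)
Lemma skew_nonassoc_psi_moves j : psi S p j <> j ->
  ~ associative (op p : skew_product S -> skew_product S -> skew_product S).
Proof.
move=> psij assoc.
have ij : psi_inv S p j <> j by move=> ij; apply: psij; rewrite -{1}ij psi_invK.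
set r := fun k => phi S p (psi_inv S p (phi S p k)).
(* The second factor on the left side is [u e]; it acts as a neutral element only on the
   image of [u], so [x_j] has to vary inside that image. *)
pose u k (b : K (r k)) : K k := emb S (phi_ge S p k) (pull b).
pose x k := u k (e (r k)).
pose x' k := if `[< k = j >] then u k (a (r k)) else u k (e (r k)).
have rhsE w b : w j = u j b ->
    op p (w j) (shift (skew_op S p (shift e) e) j) = u j b.
  move=> ->; rewrite /u {1}/shift skew_op_shift emb_op pull_op.
  by rewrite (e_neutral _).1 (e_neutral _).2.
have same : skew_op S p x (shift e) j = skew_op S p x' (shift e) j.
  by apply: skew_op_local => //; rewrite /x' asboolF.
have x'j : x' j = u j (a (r j)) by rewrite /x' asboolT.
have := skew_assoc_coord x (shift e) e j assoc.
rewrite same -(skew_assoc_coord x' (shift e) e j assoc).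
rewrite (rhsE x (e (r j)) erefl) (rhsE x' _ x'j) => ea.
exact: a_neq (esym (pull_inj (emb_inj ea))).
Qed.

(** In [skew_assoc_coord] the right side reads [z_(phi j)]; the left side
    reads [z] only at [phi (psi^-1 (phi j))], which is another index. *)
Lemma skew_nonassoc_psi_fixes j : psi S p j = j -> j <> phi S p j ->
  ~ associative (op p : skew_product S -> skew_product S -> skew_product S).
Proof.
move=> psij phij assoc.
have ij : psi_inv S p j = j by rewrite -{1}psij psiK.
have mj : phi S p (psi_inv S p (phi S p j)) <> phi S p j.
  move=> /(bij_inj (phi_bij S p)) mj.
  by apply: phij; rewrite -(psi_invK S p (phi S p j)) mj psij.
have lhsE z : op p (skew_op S p (shift e) e j) (shift z j) = shift z j.
  rewrite skew_op_shift (e_neutral _).1 pull_fixed //.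
  by rewrite /shift emb_op (e_neutral _).1.
have same : shift (skew_op S p e (bump_at (phi S p j))) j =
            shift (skew_op S p e e) j.
  by congr (emb _ _ _); apply: skew_op_local; rewrite ?bump_at_neq.
have := skew_assoc_coord (shift e) e (bump_at (phi S p j)) j assoc.
rewrite same (skew_assoc_coord (shift e) e e j assoc) !lhsE => ea.
by have := emb_inj ea; rewrite bump_at_eq => /esym/a_neq.
Qed.

End SkewCoordinates.

Theorem theorem2p5 (J : Type) (le : J -> J -> Prop) (dirJ : directed le)
    (infJ : infinite_set [set: J]) (n : nat) (K : J -> alg_object n)
    (S : skew_system le K) (ntK : forall j, nontrivial (K j)) (p : 'I_n)
    (neuK : forall j, exists e : K j, neutral (op p) e)
    (lt_phi : forall j, strict le j (phi S p j)) :
  ~ associative (op p : skew_product S -> skew_product S -> skew_product S).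
Proof.
have ea j := cid (nontrivial_neutral (ntK j) (neuK j)).
pose e j := (sval (ea j)).1; pose a j := (sval (ea j)).2.
have e_neutral j : neutral (op p) (e j) by case: (svalP (ea j)).
have a_neq j : a j <> e j by case: (svalP (ea j)).
have [j _] : [set: J] !=set0.
  by apply/set0P/eqP => J0; apply: infJ; rewrite J0; exact: finite_set0.
have [psij|psij] := pselect (psi S p j = j).
- exact: (skew_nonassoc_psi_fixes e_neutral a_neq psij (lt_phi j).2).
- exact: (skew_nonassoc_psi_moves e_neutral a_neq psij).
Qed.
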